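(* Let $G$ be a (not necessarily abelian) group and let $\mathcal{L}$ be a $G$-graded Lie algebra over a field $\mathbb{F}$. Then $\mathcal{L}$ admits a $G$-graded universal enveloping algebra $U_G(\mathcal{L})$, and it is unique up to isomorphism. Moreover, if $\{e_i\mid i\in I\}$ is a homogeneous basis of $\mathcal{L}$ indexed by a totally ordered set $I$, then the elements $$e_{i_1}\cdots e_{i_m},\quad m\ge 0,\ i_1\le\cdots\le i_m,\ [\deg e_{i_j},\deg e_{i_{j+1}}]=1\ \text{ for all } j\in\{1,\ldots,m-1\},$$ form a set of homogeneous elements that spans $U_G(\mathcal{L})$ as a vector space.
   Context: A $G$-grading on an algebra $\mathcal{A}$ (associative or Lie) is a vector space decomposition $\mathcal{A}=\bigoplus_{g\in G}\mathcal{A}_g$ with $\mathcal{A}_g\mathcal{A}_h\subseteq\mathcal{A}_{gh}$ for all $g,h\in G$ (for a Lie algebra the product is the bracket). Nonzero elements $x$ of $\mathcal{A}_g$ are homogeneous of degree $\deg x=g$. A homomorphism $\psi$ of $G$-graded algebras is graded if $\psi(\mathcal{A}_g)\subseteq\mathcal{C}_g$ for all $g$. For $g,h\in G$, $[g,h]$ denotes the group commutator. Associative algebras are unital and their homomorphisms preserve the unit. A $G$-pair $(\mathcal{L},\mathcal{A})$ consists of a $G$-graded Lie algebra $\mathcal{L}$, a $G$-graded associative algebra $\mathcal{A}$, and a linear map $\iota:\mathcal{L}\to\mathcal{A}$ with $\iota(\mathcal{L}_g)\subseteq\mathcal{A}_g$ for all $g$ and $\iota([x,y])=\iota(x)\iota(y)-\iota(y)\iota(x)$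 for all $x,y$. (The paper's convention at this stage: $\iota$ is only required to be a homomorphism, not necessarily injective. Elements of $\mathcal{L}$ are identified with their images in $\mathcal{A}$ in the notation.) A $G$-graded universal enveloping algebra of a $G$-graded Lie algebra $\mathcal{L}$ is a $G$-pair $(\mathcal{L},U_G(\mathcal{L}))$ such that (i) $U_G(\mathcal{L})$ is generated as an algebra by (the image of) $\mathcal{L}$; (ii) for every $G$-pair $(\mathcal{H},\mathcal{A})$ and every $G$-graded Lie homomorphism $\varphi:\mathcal{L}\to\mathcal{H}$, there exists a $G$-graded algebra homomorphism $U_G(\mathcal{L})\to\mathcal{A}$ extending $\varphi$ (that is, commuting with the structure maps $\mathcal{L}\to U_G(\mathcal{L})$ and $\mathcal{H}\to\mathcal{A}$). *)

(* Defs.v *)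
From HB Require Import structures.
From mathcomp Require Import all_boot all_order all_algebra.

Set Implicit Arguments.
Unset Strict Implicit.
Unset Printing Implicit Defensive.

Import GRing.Theory.
Local Open Scope ring_scope.

HB.mixin Record Lmodule_isLie (F : fieldType) L of GRing.Lmodule F L := {
  lie : L -> L -> L;
  lie_linearl : forall y, linear (fun x => lie x y);
  lie_linearr : forall x, linear (lie x);
  liexx : forall x, lie x x = 0;
  lie_jacobi : forall x y z,
    lie x (lie y z) + lie y (lie z x) + lie z (lie x y) = 0
}.

#[short(type="lieAlgType")]
HB.structure Definition LieAlgebra (F : fieldType) :=
  {L of GRing.Lmodule F L & Lmodule_isLie F L}.

(* Unital associative algebras.  The zero algebra is allowed, which [algType F]
   excludes by imposing 1 != 0; MathComp's hierarchy does not admit another join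
   of [lmodType F] and [pzRingType], so the scaling is a field of the record. *)
Record assocAlg (F : fieldType) := AssocAlg {
  aa_ring : pzRingType;
  aa_scale : F -> aa_ring -> aa_ring;
  aa_scaleA : forall (a b : F) x, aa_scale a (aa_scale b x) = aa_scale (a * b) x;
  aa_scale1 : forall x, aa_scale 1 x = x;
  aa_scaleDr : forall a x y, aa_scale a (x + y) = aa_scale a x + aa_scale a y;
  aa_scaleDl : forall x a b, aa_scale (a + b) x = aa_scale a x + aa_scale b x;
  aa_scaleAl : forall a x y, aa_scale a (x * y) = aa_scale a x * y;
  aa_scaleAr : forall a x y, aa_scale a (x * y) = x * aa_scale a y
}.

Definition aa_sort (F : fieldType) (A : assocAlg F) : Type := aa_ring A.
Coercion aa_sort : assocAlg >-> Sortclass.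

HB.instance Definition _ (F : fieldType) (A : assocAlg F) :=
  GRing.PzRing.on (aa_sort A).

HB.instance Definition _ (F : fieldType) (A : assocAlg F) :=
  GRing.Zmodule_isLmodule.Build F (aa_sort A) (@aa_scaleA F A) (@aa_scale1 F A)
    (@aa_scaleDr F A) (@aa_scaleDl F A).

Section LinearAlgebra.
Variables (F : fieldType) (V : lmodType F).

Definition is_subspace (S : V -> Prop) : Prop :=
  S 0 /\ forall (a : F) (u v : V), S u -> S v -> S (a *: u + v).

Definition linear_span (S : V -> Prop) (v : V) : Prop :=
  exists s : seq (F * V),
    (forall p, p \in s -> S p.2) /\ v = \sum_(p <- s) p.1 *: p.2.

Definition is_basis (I : choiceType) (e : I -> V) : Prop :=
  (forall (s : seq I) (c : I -> F), uniq s ->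
     \sum_(i <- s) c i *: e i = 0 -> forall i, i \in s -> c i = 0) /\
  (forall v, linear_span (fun w => exists i, w = e i) v).

(* V is the (internal) direct sum of the subspaces Vg g. *)
Definition is_direct_sum (G : choiceType) (Vg : G -> V -> Prop) : Prop :=
  [/\ forall g, is_subspace (Vg g),
      forall v, exists (s : seq G) (x : G -> V),
        (forall g, Vg g (x g)) /\ v = \sum_(g <- s) x g
    & forall (s : seq G) (x : G -> V), uniq s -> (forall g, Vg g (x g)) ->
        \sum_(g <- s) x g = 0 -> forall g, g \in s -> x g = 0].

End LinearAlgebra.

Record gradedLie (G : groupType) (F : fieldType) := GradedLie {
  gl_alg :> lieAlgType F;
  gl_comp : G -> gl_alg -> Prop;
  gl_dec : is_direct_sum gl_comp;
  gl_lie : forall g h x y,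
    gl_comp g x -> gl_comp h y -> gl_comp (g * h)%g (lie x y)
}.

Record gradedAlg (G : groupType) (F : fieldType) := GradedAlg {
  ga_alg :> assocAlg F;
  ga_comp : G -> ga_alg -> Prop;
  ga_dec : is_direct_sum ga_comp;
  ga_mul : forall g h x y,
    ga_comp g x -> ga_comp h y -> ga_comp (g * h)%g (x * y)
}.

Section Graded.
Variables (G : groupType) (F : fieldType).

(* Zero counts as homogeneous here: a monomial in a graded enveloping algebra
   may vanish. *)
Definition homogeneous (A : gradedAlg G F) (x : A) : Prop :=
  exists g, ga_comp g x.

Definition is_graded_lie_hom (L H : gradedLie G F) (phi : L -> H) : Prop :=
  [/\ linear phi,
      forall x y, phi (lie x y) = lie (phi x) (phi y)
    & forall g x, gl_comp g x -> gl_comp g (phi x)].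

Definition is_graded_alg_hom (A B : gradedAlg G F) (f : A -> B) : Prop :=
  [/\ linear f,
      f 1 = 1,
      forall x y, f (x * y) = f x * f y
    & forall g x, ga_comp g x -> ga_comp g (f x)].

(* The structure map iota need not be injective. *)
Definition is_Gpair (L : gradedLie G F) (A : gradedAlg G F)
    (iota : L -> A) : Prop :=
  [/\ linear iota,
      forall g x, gl_comp g x -> ga_comp g (iota x)
    & forall x y, iota (lie x y) = iota x * iota y - iota y * iota x].

Definition is_subalgebra (A : assocAlg F) (S : A -> Prop) : Prop :=
  [/\ is_subspace S, S 1 & forall x y, S x -> S y -> S (x * y)].

Definition generates (T : Type) (A : assocAlg F) (f : T -> A) : Prop :=
  forall S : A -> Prop, is_subalgebra S -> (forall x, S (f x)) ->
    forall a, S a.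

Definition is_graded_enveloping (L : gradedLie G F) (U : gradedAlg G F)
    (iota : L -> U) : Prop :=
  [/\ is_Gpair iota,
      generates iota
    & forall (H : gradedLie G F) (A : gradedAlg G F) (kappa : H -> A),
        is_Gpair kappa ->
        forall phi : L -> H, is_graded_lie_hom phi ->
        exists f : U -> A,
          is_graded_alg_hom f /\ forall x, f (iota x) = kappa (phi x)].

(* Isomorphism of G-pairs over the identity of L. *)
Definition Gpair_iso (L : gradedLie G F) (U U' : gradedAlg G F)
    (iota : L -> U) (iota' : L -> U') : Prop :=
  exists (f : U -> U') (f' : U' -> U),
    [/\ is_graded_alg_hom f, is_graded_alg_hom f',
        cancel f f', cancel f' f
      & forall x, f (iota x) = iota' x].

(* The elements iota e_{i_1} * ... * iota e_{i_m}, m >= 0, with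
   i_1 <= ... <= i_m and consecutive degrees commuting; [sorted r s] only
   compares neighbours in s. *)
Definition ordered_monomial (L : gradedLie G F) (U : gradedAlg G F)
    (iota : L -> U) (d : Order.disp_t) (I : orderType d)
    (e : I -> L) (deg : I -> G) (u : U) : Prop :=
  exists s : seq I,
    [/\ sorted (fun i j => (i <= j)%O) s,
        sorted (fun i j => [~ deg i, deg j]%g == 1%g) s
      & u = \prod_(i <- s) iota (e i)].

End Graded.

(* Main.v *)
Require Import Defs.
From HB Require Import structures.
From mathcomp Require Import all_boot all_order all_algebra.
From mathcomp Require Import generic_quotient boolp.

(** Existence.  A universal object is forced to be the subalgebra generated by L
    in the product of all G-pairs.  That product is too large to form, but the
    subalgebra is not: its elements are the values of formal expressions in
    elements of L ([term]), and two expressions name the same element exactly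
    when they have equal values in every G-pair ([same_value]).  Quantifying over
    all G-pairs inside a proposition raises no size problem, so the quotient
    [envel] is a legitimate algebra.  Every algebra law holds in it because it
    holds in each G-pair, the evaluation maps give the universal property, and
    the grading is also defined by evaluation: u has degree g when its value has
    degree g in every G-pair.  Homogeneous components are then independent
    because they are so in each G-pair, and they span because the sums of
    homogeneous elements form a subalgebra containing L.  The last point and
    the homogeneity of the empty monomial rely on the fact that the unit of a
    graded algebra has degree 1 ([one_homogeneous]).

    Uniqueness is the usual argument: the universal property gives maps in both
    directions, and their composites fix the generators.

    Spanning.  Let x and y be homogeneous of degrees g and h with gh <> hg.
    Then [x, y] = - [y, x] has both degrees gh and hg, so it vanishes; hence
    xy = yx in every G-pair, and this element again has two different degrees, so
    xy = 0 ([noncommuting_degrees_mul0]).  As for ordinary enveloping algebras,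
    permuting the letters of a word in the basis changes it only by a combination
    of shorter words ([word_perm]).  So modulo shorter words every word
    equals its sorted version, which is either one of the listed monomials or
    contains two neighbours with product 0.  Induction on the length finishes
    ([shorter_span]). *)

Set Implicit Arguments.
Unset Strict Implicit.
Unset Printing Implicit Defensive.

Import Order.TTheory GRing.Theory.
Local Open Scope ring_scope.
Local Open Scope quotient_scope.

(** * Subspaces, spans and direct sums *)

Lemma sum_pred1_seq (I : eqType) (V : nmodType) (s : seq I) i (f : I -> V) :
  uniq s -> i \in s -> \sum_(j <- s | j == i) f j = f i.
Proof.
move=> sU si; rewrite big_mkcond (bigD1_seq i) //= eqxx.
by rewrite big1 ?addr0 // => j /negPf->.
Qed.

Section LinearAlgebra.
Variables (F : fieldType) (V : lmodType F).
Implicit Types (S T : V -> Prop) (u v : V).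

Lemma subspaceD S u v : is_subspace S -> S u -> S v -> S (u + v).
Proof. by case=> _ SD Su Sv; rewrite -[u]scale1r; apply: SD. Qed.

Lemma subspaceZ S a u : is_subspace S -> S u -> S (a *: u).
Proof. by case=> S0 SD Su; rewrite -[_ *: _]addr0; apply: SD. Qed.

Lemma subspaceN S u : is_subspace S -> S u -> S (- u).
Proof. by move=> SS Su; rewrite -scaleN1r; apply: subspaceZ. Qed.

Lemma subspace_sum (J : eqType) S (s : seq J) (f : J -> V) (P : pred J) :
  is_subspace S -> (forall j, j \in s -> P j -> S (f j)) ->
  S (\sum_(j <- s | P j) f j).
Proof.
move=> SS Sf; rewrite big_seq_cond; apply: big_ind => [|u v|j /andP[]].
- by case: SS.
- exact: subspaceD.
- exact: Sf.
Qed.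

Lemma linear_span_incl S u : S u -> linear_span S u.
Proof.
move=> Su; exists [:: (1, u)]; rewrite big_seq1 scale1r; split=> // p.
by rewrite inE => /eqP->.
Qed.

Lemma linear_span_subspace S : is_subspace (linear_span S).
Proof.
split=> [|a u v [s [Ss ->]] [t [St ->]]]; first by exists [::]; rewrite big_nil.
exists ([seq (a * p.1, p.2) | p <- s] ++ t); split=> [p|].
  by rewrite mem_cat => /orP[/mapP[q /Ss Sq ->]//|/St].
rewrite big_cat big_map scaler_sumr; congr (_ + _).
by apply: eq_bigr => p _; rewrite scalerA.
Qed.

Lemma linear_span_min S T :
  is_subspace T -> (forall u, S u -> T u) ->
  forall u, linear_span S u -> T u.
Proof.
move=> sT ST _ [s [Ss ->]]; apply: (subspace_sum sT) => p /Ss/ST Tp _.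
exact: subspaceZ.
Qed.

Lemma linear_fun0 (W : lmodType F) (f : W -> V) : linear f -> f 0 = 0.
Proof.
by move=> flin; have := flin (-1) 0 0; rewrite !scaleN1r oppr0 addr0 addNr.
Qed.

Lemma sum_linear (W : lmodType F) (f : W -> V) (J : Type) (s : seq J)
    (x : J -> W) :
  linear f -> f (\sum_(j <- s) x j) = \sum_(j <- s) f (x j).
Proof.
move=> flin; elim: s => [|j s IHs]; first by rewrite !big_nil linear_fun0.
by rewrite !big_cons -IHs -[x j]scale1r flin !scale1r.
Qed.

Lemma preimage_subspace (W : lmodType F) (f : W -> V) S :
  linear f -> is_subspace S -> is_subspace (fun w => S (f w)).
Proof.
move=> flin [S0 SD]; split=> [|a u v Su Sv]; last by rewrite flin; apply: SD.
by rewrite linear_fun0.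
Qed.

Section Graded.
Variables (G : choiceType) (Vg : G -> V -> Prop).

(** Collecting the terms of each degree turns an arbitrary sum of homogeneous
    elements into one indexed by distinct degrees, the form in which
    independence of the components applies. *)
Lemma sum_by_degree (l : seq (G * V)) :
  (forall g, is_subspace (Vg g)) -> (forall p, p \in l -> Vg p.1 p.2) ->
  exists (s : seq G) (x : G -> V),
    [/\ uniq s, {subset [seq p.1 | p <- l] <= s}, forall g, Vg g (x g)
      & \sum_(p <- l) p.2 = \sum_(g <- s) x g].
Proof.
move=> Vsub Vl; pose s := undup [seq p.1 | p <- l].
exists s, (fun g => \sum_(p <- l | p.1 == g) p.2); split=> [||g|].
- exact: undup_uniq.
- by move=> g; rewrite mem_undup.
- by apply: subspace_sum => // p pl /eqP<-; apply: Vl.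
- rewrite (exchange_big_dep xpredT) //= big_seq [RHS]big_seq.
  apply: eq_bigr => p pl.
  under eq_bigl do rewrite eq_sym.
  by rewrite sum_pred1_seq ?undup_uniq // mem_undup map_f.
Qed.

(** Adding the zero element of degree [g0] to a decomposition makes sure that
    [g0] is listed, so that the component of degree [g0] can be read off without
    a case distinction. *)
Lemma homogeneous_decomposition (g0 : G) v :
  is_direct_sum Vg ->
  exists (s : seq G) (x : G -> V),
    [/\ uniq s, g0 \in s, forall g, Vg g (x g) & v = \sum_(g <- s) x g].
Proof.
case=> Vsub Vdec _; have [s [x [Vx ->]]] := Vdec v.
have [||t [y [tU st Vy e]]] :=
    @sum_by_degree ((g0, 0) :: [seq (g, x g) | g <- s]).
- exact: Vsub.
- by move=> p; rewrite inE => /orP[/eqP->|/mapP[g _ ->]//]; case: (Vsub g0).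
- exists t, y; split=> //; first by apply: st; rewrite inE eqxx.
  by rewrite -e big_cons add0r big_map.
Qed.

Lemma homogeneous_degree_eq g h v :
  is_direct_sum Vg -> Vg g v -> Vg h v -> g != h -> v = 0.
Proof.
move=> [Vsub _ Vind] Vgv Vhv ngh.
pose x k := if k == g then v else if k == h then - v else 0.
have xg : x g = v by rewrite /x eqxx.
have xh : x h = - v by rewrite /x eqxx eq_sym (negPf ngh).
have /(_ _ _ _ g) := Vind [:: g; h] x; rewrite xg; apply; last exact: mem_head.
- by rewrite /= inE ngh.
- move=> k; rewrite /x; case: eqP => [->//|_]; case: eqP => [->|_].
    exact: subspaceN.
  by case: (Vsub k).
- by rewrite big_cons big_seq1 xg xh subrr.
Qed.

End Graded.

End LinearAlgebra.

(** * Graded algebras *)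

Section GradedAlgebras.
Variables (G : groupType) (F : fieldType).

Lemma aalg_scaleAl (A : assocAlg F) (a : F) (x y : A) :
  a *: (x * y) = (a *: x) * y.
Proof. exact: aa_scaleAl. Qed.

Lemma aalg_scaleAr (A : assocAlg F) (a : F) (x y : A) :
  a *: (x * y) = x * (a *: y).
Proof. exact: aa_scaleAr. Qed.

Lemma linear_mull (A : assocAlg F) (x : A) : linear (fun y : A => x * y).
Proof. by move=> a u v /=; rewrite mulrDr aalg_scaleAr. Qed.

Lemma linear_mulr (A : assocAlg F) (x : A) : linear (fun y : A => y * x).
Proof. by move=> a u v /=; rewrite mulrDl aalg_scaleAl. Qed.

Lemma lieN (L : lieAlgType F) (x y : L) : lie x y = - lie y x.
Proof.
have lieDl (u v w : L) : lie (u + v) w = lie u w + lie v w.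
  by have := lie_linearl w 1 u v; rewrite !scale1r.
have lieDr (u v w : L) : lie u (v + w) = lie u v + lie u w.
  by have := lie_linearr u 1 v w; rewrite !scale1r.
have := liexx (x + y); rewrite lieDl !lieDr !liexx addr0 add0r => /eqP.
by rewrite addr_eq0 => /eqP.
Qed.

Lemma lie_noncommuting_degrees (L : gradedLie G F) g h (x y : L) :
  gl_comp g x -> gl_comp h y -> (g * h)%g != (h * g)%g -> lie x y = 0.
Proof.
move=> Lx Ly; apply: homogeneous_degree_eq (gl_dec L) _ _; first exact: gl_lie.
rewrite lieN; apply: subspaceN; first by case: (gl_dec L).
exact: gl_lie.
Qed.

(** Write 1 as a sum of components c_g.  For x of degree h, the component of
    degree h of x = x * 1 is x * c_1, so c_1 is a right unit for homogeneous
    elements, hence for 1 itself, and 1 = c_1. *)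
Lemma one_homogeneous (A : gradedAlg G F) : ga_comp 1%g (1 : A).
Proof.
have [Asub Adec Aind] := ga_dec A.
have [s [c [sU s1 Ac e1]]] := homogeneous_decomposition 1%g (1 : A) (ga_dec A).
have c1r h x : ga_comp h x -> x * c 1%g = x.
  (* [y k] is the component of degree k of x * 1 - x. *)
  move=> Ax; pose y k := x * c (h^-1 * k)%g - (if k == h then x else 0).
  have hs : h \in [seq (h * k)%g | k <- s] by apply/mapP; exists 1%g; rewrite ?mulg1.
  apply/eqP; rewrite -subr_eq0; apply/eqP.
  have := Aind _ y _ _ _ h hs; rewrite /y eqxx mulVg; apply.
  - by rewrite map_inj_uniq //; apply: mulgI.
  - move=> k; apply: subspaceD => //.
      by rewrite -{1}[k](mulVKg h); apply: ga_mul.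
    apply: subspaceN => //; case: eqP => [->//|_]; by case: (Asub k).
  - rewrite big_split sumrN /= -(big_mkcond (fun k => k == h) (fun=> x)).
    rewrite sum_pred1_seq ?map_inj_uniq //; last exact: mulgI.
    rewrite big_map; under eq_bigr do rewrite mulKg.
    by rewrite -mulr_sumr -e1 mulr1 subrr.
have -> : 1 = c 1%g; last exact: Ac.
rewrite -[c _]mul1r {1}e1 [in RHS]e1 mulr_suml.
by apply: eq_bigr => g _; rewrite (c1r g).
Qed.

End GradedAlgebras.

(** * Existence: the subalgebra generated by L in all G-pairs at once *)

Section Construction.
Variables (G : groupType) (F : fieldType) (L : gradedLie G F).

(** Zero and opposites are the multiples by 0 and -1, so they need no
    constructor. *)
Inductive term : Type :=
  | Gen of L
  | One
  | Add of term & term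
  | Mul of term & term
  | Scale of F & term.

HB.instance Definition _ := gen_eqMixin term.
HB.instance Definition _ := gen_choiceMixin term.

Fixpoint eval (A : gradedAlg G F) (kappa : L -> A) (t : term) : A :=
  match t with
  | Gen x => kappa x
  | One => 1
  | Add t1 t2 => eval kappa t1 + eval kappa t2
  | Mul t1 t2 => eval kappa t1 * eval kappa t2
  | Scale a t1 => a *: eval kappa t1
  end.

Definition same_value (s t : term) : Prop :=
  forall (A : gradedAlg G F) (kappa : L -> A), is_Gpair kappa ->
    eval kappa s = eval kappa t.

Definition same_valueb : rel term := fun s t => `[< same_value s t >].

Lemma same_value_refl : reflexive same_valueb.
Proof. by move=> s; apply/asboolP. Qed.

Lemma same_value_sym : symmetric same_valueb.
Proof. by move=> s t; apply/asboolP/asboolP => st A k Pk; rewrite st. Qed.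

Lemma same_value_trans : transitive same_valueb.
Proof.
by move=> s t u /asboolP ts /asboolP su; apply/asboolP => A k Pk; rewrite ts ?su.
Qed.

Canonical same_value_equiv :=
  EquivRel same_valueb same_value_refl same_value_sym same_value_trans.

Definition envel := {eq_quot same_value_equiv}.

HB.instance Definition _ := Choice.on envel.

Definition class_of (t : term) : envel := \pi t.

(** The homomorphism from the enveloping algebra given by a G-pair. *)
Definition value (A : gradedAlg G F) (kappa : L -> A) (u : envel) : A :=
  eval kappa (repr u).

Lemma value_class (A : gradedAlg G F) (kappa : L -> A) t :
  is_Gpair kappa -> value kappa (class_of t) = eval kappa t.
Proof.
move=> Pk; have /eqmodP/asboolP : repr (class_of t) = t
  %[mod_eq same_value_equiv] by rewrite reprK.
exact.
Qed.

(** This single principle transfers every identity valid in all G-pairs to the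
    quotient. *)
Lemma envel_ext (u v : envel) :
  (forall (A : gradedAlg G F) (kappa : L -> A), is_Gpair kappa ->
     value kappa u = value kappa v) -> u = v.
Proof.
by move=> uv; rewrite -[u]reprK -[v]reprK; apply/eqmodP/asboolP.
Qed.

Definition envel_zero := class_of (Scale 0 One).
Definition envel_one := class_of One.
Definition envel_add (u v : envel) := class_of (Add (repr u) (repr v)).
Definition envel_mul (u v : envel) := class_of (Mul (repr u) (repr v)).
Definition envel_scale (a : F) (u : envel) := class_of (Scale a (repr u)).
Definition envel_opp (u : envel) := class_of (Scale (-1) (repr u)).

Section ValueOperations.
Variables (A : gradedAlg G F) (kappa : L -> A) (Pkappa : is_Gpair kappa).
Implicit Types u v : envel.

Lemma value0 : value kappa envel_zero = 0.
Proof. by rewrite value_class //= scale0r. Qed.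

Lemma value1 : value kappa envel_one = 1.
Proof. exact: value_class. Qed.

Lemma valueD u v : value kappa (envel_add u v) = value kappa u + value kappa v.
Proof. exact: value_class. Qed.

Lemma valueM u v : value kappa (envel_mul u v) = value kappa u * value kappa v.
Proof. exact: value_class. Qed.

Lemma valueZ a u : value kappa (envel_scale a u) = a *: value kappa u.
Proof. exact: value_class. Qed.

Lemma valueN u : value kappa (envel_opp u) = - value kappa u.
Proof. by rewrite value_class //= scaleN1r. Qed.

Definition valueE := (value0, value1, valueD, valueM, valueZ, valueN).

End ValueOperations.

Ltac by_values :=
  repeat intro; apply: envel_ext => ? ? ?; rewrite ?valueE //.

Fact envel_addA : associative envel_add.
Proof. by by_values; rewrite addrA. Qed.
Fact envel_addC : commutative envel_add.
Proof. by by_values; rewrite addrC. Qed.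
Fact envel_add0 : left_id envel_zero envel_add.
Proof. by by_values; rewrite add0r. Qed.
Fact envel_addN : left_inverse envel_zero envel_opp envel_add.
Proof. by by_values; rewrite addNr. Qed.

HB.instance Definition _ :=
  GRing.isZmodule.Build envel envel_addA envel_addC envel_add0 envel_addN.

Fact envel_mulA : associative envel_mul.
Proof. by by_values; rewrite mulrA. Qed.
Fact envel_mul1l : left_id envel_one envel_mul.
Proof. by by_values; rewrite mul1r. Qed.
Fact envel_mul1r : right_id envel_one envel_mul.
Proof. by by_values; rewrite mulr1. Qed.
Fact envel_mulDl : left_distributive envel_mul envel_add.
Proof. by by_values; rewrite mulrDl. Qed.
Fact envel_mulDr : right_distributive envel_mul envel_add.
Proof. by by_values; rewrite mulrDr. Qed.

HB.instance Definition _ := GRing.Zmodule_isPzRing.Build envel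
  envel_mulA envel_mul1l envel_mul1r envel_mulDl envel_mulDr.

Fact envel_scaleA a b u :
  envel_scale a (envel_scale b u) = envel_scale (a * b) u.
Proof. by by_values; rewrite scalerA. Qed.
Fact envel_scale1 u : envel_scale 1 u = u.
Proof. by by_values; rewrite scale1r. Qed.
Fact envel_scaleDr a (u v : envel) :
  envel_scale a (u + v) = envel_scale a u + envel_scale a v.
Proof. by by_values; rewrite scalerDr. Qed.
Fact envel_scaleDl (u : envel) a b :
  envel_scale (a + b) u = envel_scale a u + envel_scale b u.
Proof. by by_values; rewrite scalerDl. Qed.
Fact envel_scaleAl a (u v : envel) :
  envel_scale a (u * v) = envel_scale a u * v.
Proof. by by_values; rewrite aalg_scaleAl. Qed.
Fact envel_scaleAr a (u v : envel) :
  envel_scale a (u * v) = u * envel_scale a v.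
Proof. by by_values; rewrite aalg_scaleAr. Qed.

Definition envelAlg : assocAlg F := @AssocAlg F envel envel_scale
  envel_scaleA envel_scale1 envel_scaleDr envel_scaleDl
  envel_scaleAl envel_scaleAr.

Definition envel_iota (x : L) : envelAlg := class_of (Gen x).

Lemma value_iota (A : gradedAlg G F) (kappa : L -> A) x :
  is_Gpair kappa -> value kappa (envel_iota x) = kappa x.
Proof. by move=> Pk; apply: value_class. Qed.

Lemma value_linear (A : gradedAlg G F) (kappa : L -> A) :
  is_Gpair kappa -> linear (value kappa : envelAlg -> A).
Proof. by move=> Pk a u v; rewrite valueD // valueZ. Qed.

Lemma envel_iota_linear : linear envel_iota.
Proof.
move=> a x y; apply: envel_ext => A kappa Pk; rewrite value_linear //.
by rewrite !value_iota //; case: Pk => ->.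
Qed.

Lemma envel_iota_lie x y :
  envel_iota (lie x y) =
  envel_iota x * envel_iota y - envel_iota y * envel_iota x.
Proof.
apply: envel_ext => A kappa Pk; rewrite valueD // valueN // !valueM //.
by rewrite !value_iota //; case: Pk.
Qed.

Lemma envel_generates : generates envel_iota.
Proof.
move=> S [SS S1 SM] Siota u.
have classE (t : term) (v : envelAlg) :
    (forall (A : gradedAlg G F) (kappa : L -> A), is_Gpair kappa ->
       eval kappa t = value kappa v) -> class_of t = v.
  by move=> tv; apply: envel_ext => A k Pk; rewrite value_class ?tv.
rewrite -[u]reprK -/(class_of _); elim: (repr u) => [x||s Ss t St|s Ss t St|a t St].
- exact: Siota.
- exact: S1.
- rewrite (@classE _ ((class_of s : envelAlg) + class_of t)).
    exact: subspaceD.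
  by move=> A k Pk; rewrite valueD // !value_class.
- rewrite (@classE _ ((class_of s : envelAlg) * class_of t)); first exact: SM.
  by move=> A k Pk; rewrite valueM // !value_class.
- rewrite (@classE _ (a *: (class_of t : envelAlg))); first exact: subspaceZ.
  by move=> A k Pk; rewrite valueZ // !value_class.
Qed.

Definition envel_comp (g : G) (u : envelAlg) : Prop :=
  forall (A : gradedAlg G F) (kappa : L -> A), is_Gpair kappa ->
    ga_comp g (value kappa u).

Lemma envel_comp_subspace g : is_subspace (envel_comp g).
Proof.
split=> [A k Pk|a u v Cu Cv A k Pk].
  by rewrite value0 //; case: (ga_dec A) => /(_ g)[].
rewrite value_linear //; case: (ga_dec A) => /(_ g)[_ AD] _ _.
by apply: AD; [apply: Cu | apply: Cv].
Qed.

Lemma envel_comp_mul g h u v :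
  envel_comp g u -> envel_comp h v -> envel_comp (g * h)%g (u * v).
Proof.
move=> Cu Cv A k Pk; rewrite valueM //.
by apply: ga_mul; [apply: Cu | apply: Cv].
Qed.

Lemma envel_comp_one : envel_comp 1%g 1.
Proof. by move=> A k Pk; rewrite value1 //; apply: one_homogeneous. Qed.

Lemma envel_comp_iota g x : gl_comp g x -> envel_comp g (envel_iota x).
Proof. by move=> Lx A k Pk; rewrite value_iota //; case: Pk => _ kdeg _; apply: kdeg. Qed.

(** The span of the homogeneous elements is a subalgebra containing the
    image of L. *)
Lemma envel_span_comp u :
  linear_span (fun v => exists g, envel_comp g v) u.
Proof.
apply: (envel_generates
  (S := linear_span (fun v => exists g, envel_comp g v))) => [|x]; last first.
  have [_ /(_ x)[s [y [Ly ->]]] _] := gl_dec L.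
  rewrite sum_linear; last exact: envel_iota_linear.
  apply: subspace_sum => [|g _ _]; first exact: linear_span_subspace.
  by apply: linear_span_incl; exists g; apply: envel_comp_iota.
split=> [||u1 v1 hu hv]; first exact: linear_span_subspace.
  by apply: linear_span_incl; exists 1%g; apply: envel_comp_one.
pose W := linear_span (fun v => exists g, envel_comp g v).
have sW : is_subspace W by apply: linear_span_subspace.
apply: (linear_span_min (preimage_subspace (linear_mulr v1) sW)) hu.
move=> {}u1 [g Cu].
apply: (linear_span_min (preimage_subspace (linear_mull u1) sW)) hv.
move=> {}v1 [h Cv].
by apply: linear_span_incl; exists (g * h)%g; apply: envel_comp_mul.
Qed.

Lemma envel_dec : is_direct_sum envel_comp.
Proof.
split=> [g|u|s x sU Cx sx0 g gs]; first exact: envel_comp_subspace.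
  have [l [lC ->]] := envel_span_comp u.
  elim: l lC => [|p l IHl] lC.
    exists [::], (fun=> 0); split=> [g|]; last by rewrite !big_nil.
    by case: (envel_comp_subspace g).
  have [|s [x [Cx el]]] := IHl; first by move=> q ql; apply: lC; rewrite inE ql orbT.
  have [g Cp] := lC p (mem_head _ _).
  have [||t [y [_ _ Cy ey]]] := @sum_by_degree _ _ _ envel_comp
    ((g, p.1 *: p.2) :: [seq (h, x h) | h <- s]).
  - exact: envel_comp_subspace.
  - move=> q; rewrite inE => /orP[/eqP->|/mapP[h _ ->]//] /=.
    exact: (subspaceZ _ (envel_comp_subspace g) Cp).
  - exists t, y; split=> //.
    by rewrite big_cons el -ey big_cons big_map.
apply: envel_ext => A k Pk; rewrite value0 //.
case: (ga_dec A) => _ _ Aind; apply: (Aind s (fun g => value k (x g))) => // [h|].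
  exact: Cx.
rewrite -(sum_linear s x (value_linear Pk)) sx0; exact: value0.
Qed.

Definition envelGraded : gradedAlg G F :=
  @GradedAlg G F envelAlg envel_comp envel_dec envel_comp_mul.

Lemma envel_is_enveloping : @is_graded_enveloping G F L envelGraded envel_iota.
Proof.
split=> [||H A kappa Pkappa phi Hphi].
- split; first exact: envel_iota_linear.
    exact: envel_comp_iota.
  exact: envel_iota_lie.
- exact: envel_generates.
(* Since kappa o phi is itself a G-pair for L, the required map is the
   corresponding evaluation. *)
have Pk : is_Gpair (kappa \o phi).
  case: Pkappa => klin kdeg klie; case: Hphi => plin plie pdeg.
  split=> [a x y|g x Lx|x y] /=; first by rewrite plin klin.
    by apply/kdeg/pdeg.
  by rewrite plie klie.
exists (value (kappa \o phi)); split=> [|x]; last exact: value_iota.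
split=> [|| u v|g u Cu]; first exact: value_linear.
- exact: value1.
- exact: valueM.
- exact: Cu.
Qed.

End Construction.

(** * Uniqueness *)

Section Uniqueness.
Variables (G : groupType) (F : fieldType) (L : gradedLie G F).

Lemma enveloping_hom (U A : gradedAlg G F) (iota : L -> U) (kappa : L -> A) :
  is_graded_enveloping iota -> is_Gpair kappa ->
  exists f : U -> A,
    is_graded_alg_hom f /\ forall x, f (iota x) = kappa x.
Proof. by case=> _ _ univ Pk; apply: (univ L A kappa Pk id). Qed.

Lemma graded_alg_hom_comp (A B C : gradedAlg G F) (f : A -> B) (g : B -> C) :
  is_graded_alg_hom f -> is_graded_alg_hom g -> is_graded_alg_hom (g \o f).
Proof.
move=> [fl f1 fM fdeg] [gl g1 gM gdeg]; split=> [a u v||u v|h u Au] /=.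
- by rewrite fl gl.
- by rewrite f1.
- by rewrite fM gM.
- by apply/gdeg/fdeg.
Qed.

Lemma generated_endomorphism_id (U : gradedAlg G F) (iota : L -> U) (f : U -> U) :
  generates iota -> is_graded_alg_hom f -> (forall x, f (iota x) = iota x) ->
  forall u, f u = u.
Proof.
move=> gen [fl f1 fM _] fiota.
apply: (gen (fun u => f u = u)) => //; split=> // [|u v fu fv].
  by split=> [|a u v fu fv]; [apply: linear_fun0 | rewrite fl fu fv].
by rewrite fM fu fv.
Qed.

Lemma enveloping_unique (U U' : gradedAlg G F) (iota : L -> U)
    (iota' : L -> U') :
  is_graded_enveloping iota -> is_graded_enveloping iota' ->
  Gpair_iso iota iota'.
Proof.
move=> EU EU'; have [PU gU _] := EU; have [PU' gU' _] := EU'.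
have [f [fhom fi]] := enveloping_hom EU PU'.
have [f' [f'hom f'i]] := enveloping_hom EU' PU.
exists f, f'; split=> //.
- apply: (generated_endomorphism_id gU (graded_alg_hom_comp fhom f'hom)) => x /=.
  by rewrite fi f'i.
- apply: (generated_endomorphism_id gU' (graded_alg_hom_comp f'hom fhom)) => x /=.
  by rewrite f'i fi.
Qed.

End Uniqueness.

(** * Spanning by ordered monomials with commuting neighbours *)

Section Spanning.
Variables (G : groupType) (F : fieldType) (L : gradedLie G F).
Variables (U : gradedAlg G F) (iota : L -> U).
Hypothesis (Piota : is_Gpair iota).

Let iota_lin : linear iota. Proof. by case: Piota. Qed.
Let iota_lie x y : iota (lie x y) = iota x * iota y - iota y * iota x.
Proof. by case: Piota. Qed.
Let iota_deg g x : gl_comp g x -> ga_comp g (iota x).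
Proof. by case: Piota => _ + _; apply. Qed.

(** The bracket has two degrees, so it vanishes and x, y commute in U; then
    their product has both degrees gh and hg and vanishes as well. *)
Lemma noncommuting_degrees_mul0 g h x y :
  gl_comp g x -> gl_comp h y -> (g * h)%g != (h * g)%g -> iota x * iota y = 0.
Proof.
move=> Lx Ly ngh.
have xy_yx : iota x * iota y = iota y * iota x.
  apply/eqP; rewrite -subr_eq0 -iota_lie.
  by rewrite (lie_noncommuting_degrees Lx Ly) ?linear_fun0.
apply: homogeneous_degree_eq (ga_dec U) _ _ ngh.
  by apply: ga_mul; apply: iota_deg.
by rewrite xy_yx; apply: ga_mul; apply: iota_deg.
Qed.

Section Words.
Variables (I : eqType) (e : I -> L).

Definition word (s : seq I) : U := \prod_(i <- s) iota (e i).

Definition shorter (n : nat) : U -> Prop :=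
  linear_span (fun u => exists2 s, (size s < n)%N & u = word s).

Lemma shorter_subspace n : is_subspace (shorter n).
Proof. exact: linear_span_subspace. Qed.

Lemma word_cons i s : word (i :: s) = iota (e i) * word s.
Proof. exact: big_cons. Qed.

Lemma word_homogeneous (deg : I -> G) s :
  (forall i, gl_comp (deg i) (e i)) -> homogeneous (word s).
Proof.
move=> edeg; elim: s => [|i s [g Us]].
  by exists 1%g; rewrite /word big_nil; apply: one_homogeneous.
by exists (deg i * g)%g; rewrite word_cons; apply: ga_mul; first exact: iota_deg.
Qed.

Lemma word_noncommuting_eq0 (deg : I -> G) s :
  (forall i, gl_comp (deg i) (e i)) ->
  ~~ sorted (fun i j => [~ deg i, deg j]%g == 1%g) s -> word s = 0.
Proof.
move=> edeg; elim: s => [|i [|j s] IHs] //= /nandP[ij|].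
  rewrite !word_cons mulrA (noncommuting_degrees_mul0 (edeg i) (edeg j)) ?mul0r //.
  by apply: contra ij => /eqP ij; apply/commgP.
by move=> /IHs js; rewrite word_cons js mulr0.
Qed.

Hypothesis (ebasis : forall x, linear_span (fun w => exists i, w = e i) x).

(** Here [x] is any element of L, so that the statement also covers brackets of
    basis elements. *)
Lemma shorter_mul n x u : shorter n u -> shorter n.+1 (iota x * u).
Proof.
have sS := shorter_subspace n.+1.
apply: (linear_span_min (preimage_subspace (linear_mull (iota x)) sS)).
move=> {}u [s sn ->].
have lin : linear (fun y => iota y * word s).
  by move=> a y z; rewrite iota_lin; apply: linear_mulr.
move: (ebasis x); apply: (linear_span_min (preimage_subspace lin sS)).
move=> _ [i ->]; apply: linear_span_incl.
by exists (i :: s); rewrite ?word_cons.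
Qed.

(** Each transposition of neighbours produces a word in which the two letters
    are replaced by their bracket, a combination of single letters. *)
Lemma word_move_to_front i s t :
  shorter (size (s ++ t)).+1 (word (s ++ i :: t) - word (i :: s ++ t)).
Proof.
elim: s => [|j s IHs]; first by rewrite subrr; case: (shorter_subspace (size t).+1).
rewrite [(j :: s) ++ _]/= [(j :: s) ++ _]/= [size _]/= !word_cons.
have -> : iota (e j) * word (s ++ i :: t) - iota (e i) * (iota (e j) * word (s ++ t))
    = iota (e j) * (word (s ++ i :: t) - word (i :: s ++ t))
      + iota (lie (e j) (e i)) * word (s ++ t).
  by rewrite iota_lie word_cons mulrBr mulrBl !mulrA addrA subrK.
apply: (subspaceD (shorter_subspace _)); first exact: shorter_mul.
by apply: shorter_mul; apply: linear_span_incl; exists (s ++ t).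
Qed.

Lemma word_perm s t : perm_eq s t -> shorter (size s) (word s - word t).
Proof.
elim: s t => [|i s IHs] t.
  by rewrite perm_sym => /perm_nilP->; rewrite subrr; case: (shorter_subspace 0).
move=> ist; have ti : i \in t by rewrite -(perm_mem ist) mem_head.
case/splitPr: ti ist => t1 t2.
rewrite perm_sym -cat1s perm_catCA /= perm_cons perm_sym => st.
have -> : word (i :: s) - word (t1 ++ i :: t2)
    = iota (e i) * (word s - word (t1 ++ t2))
      + - (word (t1 ++ i :: t2) - word (i :: t1 ++ t2)).
  by rewrite mulrBr -!word_cons opprB addrA subrK.
apply: (subspaceD (shorter_subspace _)); first by apply: shorter_mul; apply: IHs.
apply: (subspaceN (shorter_subspace _)).
by rewrite /= (perm_size st); apply: word_move_to_front.
Qed.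

End Words.

Variables (d : Order.disp_t) (I : orderType d) (e : I -> L) (deg : I -> G).
Hypothesis (ebasis : forall x, linear_span (fun w => exists i, w = e i) x).
Hypothesis (edeg : forall i, gl_comp (deg i) (e i)).

(** Sorting a word costs only shorter words; the sorted word is an ordered
    monomial unless two neighbouring degrees fail to commute, and then it is
    zero. *)
Lemma shorter_span n u :
  shorter e n u -> linear_span (ordered_monomial iota e deg) u.
Proof.
have sW := linear_span_subspace (ordered_monomial iota e deg).
elim: n u => [|n IHn]; apply: (linear_span_min sW) => _ [s sn ->] //.
pose t := sort (fun i j => (i <= j)%O) s.
have st : perm_eq s t by rewrite perm_sym perm_sort.
rewrite -(subrK (word e t) (word e s)); apply: (subspaceD sW).
  apply: IHn; move: (word_perm ebasis st).
  apply: linear_span_min; first exact: shorter_subspace.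
  move=> _ [r rs ->]; apply: linear_span_incl; exists r => //.
  exact: leq_trans rs _.
have [tc|tnc] := boolP (sorted (fun i j => [~ deg i, deg j]%g == 1%g) t).
  by apply: linear_span_incl; exists t; split=> //; apply/sort_sorted/le_total.
by rewrite (word_noncommuting_eq0 edeg tnc); case: sW.
Qed.

Lemma ordered_monomials_span u :
  generates iota -> linear_span (ordered_monomial iota e deg) u.
Proof.
pose W := linear_span (ordered_monomial iota e deg).
have sW : is_subspace W by apply: linear_span_subspace.
(* The elements whose left multiplication preserves W form a subalgebra, so it
   suffices to treat the generators; apply the result to 1. *)
move=> gen; suff Wmul w : W w -> W (u * w).
  rewrite -[u]mulr1; apply: Wmul; apply: linear_span_incl.
  by exists [::]; rewrite big_nil.
move: w; apply: (gen (fun u => forall w, W w -> W (u * w))) => [|x w].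
  split=> [||u1 u2 W1 W2 w Ww].
  - split=> [w _|a u1 u2 W1 W2 w Ww]; first by rewrite mul0r; case: sW.
    by rewrite linear_mulr; case: (sW) => _ WD; apply: WD; [apply: W1 | apply: W2].
  - by move=> w; rewrite mul1r.
  - by rewrite -mulrA; apply/W1/W2.
apply: (linear_span_min (preimage_subspace (linear_mull (iota x)) sW)).
move=> _ [s [_ _ ->]]; apply: (@shorter_span (size s).+2).
by apply: shorter_mul => //; apply: linear_span_incl; exists s.
Qed.

End Spanning.

Theorem theorem9 (G : groupType) (F : fieldType) (L : gradedLie G F) :
  (exists (U : gradedAlg G F) (iota : L -> U), is_graded_enveloping iota) /\
  (forall (U U' : gradedAlg G F) (iota : L -> U) (iota' : L -> U'),
     is_graded_enveloping iota -> is_graded_enveloping iota' ->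
     Gpair_iso iota iota') /\
  (forall (U : gradedAlg G F) (iota : L -> U), is_graded_enveloping iota ->
     forall (d : Order.disp_t) (I : orderType d) (e : I -> L) (deg : I -> G),
     is_basis e -> (forall i, gl_comp (deg i) (e i)) ->
     (forall u, ordered_monomial iota e deg u -> homogeneous u) /\
     (forall u, linear_span (ordered_monomial iota e deg) u)).
Proof.
split; first by exists (envelGraded L), (@envel_iota G F L); apply: envel_is_enveloping.
split; first exact: enveloping_unique.
move=> U iota [Piota gen _] d I e deg [_ espan] edeg; split=> u.
  by move=> [s [_ _ ->]]; apply: (word_homogeneous Piota s edeg).
exact: ordered_monomials_span.
Qed.
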